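(* For every fixed real $\varepsilon > 0$ there exists $q_0 = q_0(\varepsilon)$ such that the following holds for every integer $q \ge q_0$ and every integer $a$ with $\gcd(a,q) = 1$. For any integer $Q \ge q^{2+\varepsilon}$ there are integers $a_1, a_2, a_3$ and integers $q_1, q_2, q_3$ with $1 \le q_i \le 2 Q^{1/3}$ for $i = 1, 2, 3$, such that $$ \left| \frac{a}{q} - \frac{a_1}{q_1} - \frac{a_2}{q_2} - \frac{a_3}{q_3}\right| \le \frac{1}{qQ}. $$
   Context: The numerators $a_1, a_2, a_3$ are arbitrary integers (they may be negative or zero). ''Sufficiently large $q$'' means that $q$ exceeds a bound depending only on $\varepsilon$. *)

(* Defs.v *)
From mathcomp Require Import all_boot all_order all_algebra.
From mathcomp Require Import reals exp.

(* Main.v *)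
Require Import Defs.
From mathcomp Require Import all_boot all_order all_algebra.
From mathcomp Require Import zify ring lra.
From mathcomp Require Import reals exp trigo complex.
Set Implicit Arguments. Unset Strict Implicit. Unset Printing Implicit Defensive.
Import Order.TTheory GRing.Theory Num.Theory.

(** Let N = floor(Q^(1/3)).  If q <= 2N, the denominator q itself is allowed.
    Otherwise it suffices to find pairwise coprime x, y, z in (N, 2N] with
    a x y z = 1 mod q: then (a x y z - 1) / q is an integer combination of y z,
    x z and x y, and the error is exactly 1 / (q x y z) < 1 / (q Q).

    Take x and z in disjoint sets X and Z of primes from one half of (N, 2N]
    (Chebyshev's bound provides about N / log N of them) and y = s + i + j in the
    other half, with i, j < L = N / 4.  Let F(t) count the representations
    t = z (s + i + j) mod q.  If the congruence had no solution, F would vanish at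
    the |X| residues (a x)^-1, so Parseval would give
      |X| (|Z| L^2)^2 <= q * sum_(u != 0) (sum_(z in Z) B(u z))^2
    with the Fejer weight B(u) = |sum_(i < L) e(u i / q)|^2 <= min(L^2, (q / ||u||)^2).
    Expanding the square and putting h for the larger of u z and u p, one has to
    count the primes z in Z with ||h p / z|| <= ||h||.  Such a z divides one of the
    nonzero integers h p + i q with |i| <= 4 N ||h|| / q, and each of them has at most
    three prime factors > N.  The right-hand side is therefore O(|Z| L^2 q^2 N log q),
    which is too small as soon as N^3 exceeds q^2 (log q)^3 by a constant factor. *)

(** * Primes between N and 2N *)

Lemma coprime_prod_seq p (s : seq nat) :
  {in s, forall q, coprime p q} -> coprime p (\prod_(q <- s) q).
Proof.
move=> cop; rewrite big_seq; apply: (big_ind (coprime p)) => //; first exact: coprimen1.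
by move=> x y; rewrite coprimeMr => -> ->.
Qed.

Lemma prod_primes_dvd (s : seq nat) n :
  uniq s -> all prime s -> all (dvdn^~ n) s -> \prod_(p <- s) p %| n.
Proof.
elim: s => [|p s IHs] /=; first by rewrite big_nil dvd1n.
case/andP=> ps us /andP[pp prs] /andP[pn dvds]; rewrite big_cons Gauss_dvd ?pn ?IHs //.
apply: coprime_prod_seq => q qs; rewrite prime_coprime // dvdn_prime2 ?(allP prs q qs) //.
by apply/eqP => epq; rewrite epq qs in ps.
Qed.

Lemma expn_size_leq_prod a (s : seq nat) :
  {in s, forall p, a <= p} -> a ^ size s <= \prod_(p <- s) p.
Proof.
elim: s => [|p s IHs] le_a /=; first by rewrite big_nil.
rewrite big_cons expnS leq_mul ?le_a ?mem_head //.
by apply: IHs => q qs; rewrite le_a // inE qs orbT.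
Qed.

(** Distinct primes dividing [n] have a product dividing [n], and the product of [k.+1] of them
    would exceed [n]. *)
Lemma count_prime_divisors (s : seq nat) a k n :
  uniq s -> all prime s -> {in s, forall p, a < p} -> 0 < n < a.+1 ^ k.+1 ->
  count (dvdn^~ n) s <= k.
Proof.
move=> us prs lt_a /andP[n0 ltn]; rewrite -size_filter leqNgt; apply/negP => lt_k.
have: a.+1 ^ k.+1 <= n; last by rewrite leqNgt ltn.
apply: leq_trans (_ : a.+1 ^ size (filter (dvdn^~ n) s) <= _).
  by rewrite leq_pexp2l.
apply: leq_trans (_ : \prod_(p <- filter (dvdn^~ n) s) p <= _).
  by apply: expn_size_leq_prod => p; rewrite mem_filter => /andP[_ /lt_a].
apply/dvdn_leq/prod_primes_dvd => //; rewrite ?filter_uniq //.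
  by apply/allP=> p; rewrite mem_filter => /andP[_ /(allP prs)].
by apply/allP=> p; rewrite mem_filter => /andP[].
Qed.

(** * Central binomial coefficients and Chebyshev's bound *)

Lemma mul_central_bin n : n.+1 * 'C(n.+1.*2, n.+1) = (n.*2.+1).*2 * 'C(n.*2, n).
Proof.
rewrite doubleS.
have e1 : 'C(n.*2.+2, n.+1) = 'C(n.*2.+1, n.+1).*2.
  rewrite binS -[RHS]addnn; congr (_ + _); rewrite -[RHS]bin_sub; last by lia.
  by congr 'C(_, _); lia.
rewrite e1 -doubleMr -(mul_bin_diag n.*2.+1) /=; lia.
Qed.

Lemma central_bin_lower n : 0 < n -> 4 ^ n <= n.*2 * 'C(n.*2, n).
Proof.
case: n => // n _; elim: n => [|n IHn] //.
have := mul_central_bin n.+1; rewrite expnS; nia.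
Qed.

(** The two equal middle terms in the expansion of (1 + 1)^(2m + 1) sum to at most the whole. *)
Lemma odd_bin_upper m : 'C(m.*2.+1, m.+1) <= 4 ^ m.
Proof.
have : 'C(m.*2.+1, m.+1).*2 <= 2 ^ m.*2.+1.
  rewrite -[2]/(1 + 1) expnDn.
  under eq_bigr do rewrite !exp1n !muln1.
  have lm : m.+1 < m.*2.+2 by lia.
  have lm' : m < m.*2.+2 by lia.
  rewrite (bigD1 (Ordinal lm)) // (bigD1 (Ordinal lm')) /=; last first.
    by rewrite -val_eqE /=; lia.
  rewrite addnA -[X in _ <= X + _ + _]muln1 -addnn.
  apply: leq_trans (leq_addr _ _); rewrite muln1 leq_add2l.
  by rewrite -[X in _ <= X]bin_sub; [rewrite (_ : m.*2.+1 - m = m.+1) //; lia | lia].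
by rewrite (_ : 2 ^ m.*2.+1 = (4 ^ m).*2) ?leq_double // expnS mul2n -[m.*2]mul2n expnM.
Qed.

Lemma prime_dvd_fact p n : prime p -> p %| n`! -> p <= n.
Proof.
move=> pp; elim: n => [|n IHn]; first by rewrite dvdn1 => /eqP p1; rewrite p1 in pp.
rewrite factS Euclid_dvdM // => /orP[/dvdn_leq->//|/IHn]; lia.
Qed.

(** Erdos's induction: for n = 2h + 1 every prime in (h + 1, 2h + 1] divides ['C(h.*2.+1, h.+1)],
    which is at most 4^h; an even n > 2 is not prime and reduces to n - 1. *)
Lemma primorial_leq n : \prod_(0 <= p < n.+1 | prime p) p <= 4 ^ n.
Proof.
have [m] := ubnP n; elim: m n => // m IHm n ltn.
have [n2|n2] := leqP n 2.
  by case: n ltn n2 => [|[|[|]]] // *; rewrite unlock.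
have [odd_n|ev_n] := boolP (odd n); last first.
  have np : ~~ prime n by apply/negP => /even_prime[]; lia.
  case: n ltn n2 np {ev_n} => // n ltn n2 np.
  rewrite big_mkcond big_nat_recr //= -big_mkcond (negPf np) muln1.
  by apply: leq_trans (IHm n _) _; [lia | rewrite leq_exp2l].
pose h := n./2; have nE : n = h.*2.+1 by rewrite -[LHS]odd_double_half odd_n.
rewrite nE (@big_cat_nat _ _ _ h.+2) //=; last by lia.
have -> : 4 ^ h.*2.+1 = 4 ^ h.+1 * 4 ^ h by rewrite -expnD; congr (_ ^ _); lia.
apply: leq_mul; first by apply: IHm; lia.
apply: leq_trans (odd_bin_upper h); apply: dvdn_leq; first by rewrite bin_gt0; lia.
rewrite -big_filter; apply: prod_primes_dvd.
- by rewrite filter_uniq ?iota_uniq.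
- by apply/allP=> p; rewrite mem_filter => /andP[].
apply/allP=> p; rewrite mem_filter mem_index_iota => /andP[pp /andP[p1 p2]].
have : p %| (h.*2.+1)`! by apply: dvdn_fact; lia.
rewrite -(@bin_fact _ h.+1); last by lia.
rewrite Euclid_dvdM // Euclid_dvdM // => /or3P[//||] /(prime_dvd_fact pp); lia.
Qed.

Lemma logn_central_bin p n : prime p ->
  logn p 'C(n.*2, n) = \sum_(1 <= k < n.*2.+1) (n.*2 %/ p ^ k - (n %/ p ^ k).*2).
Proof.
move=> pp; have le_n : n <= n.*2 by lia.
have := logn_fact n.*2 pp; rewrite -(bin_fact le_n) -[in n.*2 - n]addnn addnK.
rewrite !lognM ?muln_gt0 ?fact_gt0 ?bin_gt0 //.
rewrite (logn_fact n pp) addnn => e.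
have e2 : \sum_(1 <= k < n.+1) n %/ p ^ k = \sum_(1 <= k < n.*2.+1) n %/ p ^ k.
  rewrite [RHS](@big_cat_nat _ _ _ n.+1) //=.
  rewrite [X in _ + X]big_nat [X in _ + X]big1 ?addn0 // => k /andP[k1 k2].
  by rewrite divn_small // (leq_ltn_trans _ (ltn_expl k (prime_gt1 pp))) // ltnW.
rewrite sumnB; last by move=> k _; rewrite leq_divRL ?expn_gt0 ?prime_gt0 // -doubleMl leq_double leq_divM.
under [X in _ - X]eq_bigr do rewrite -addnn.
by rewrite big_split /= -e -e2 addnn addnK.
Qed.

(** Each term of the Legendre sum is 0 or 1, and the terms with p^k > 2n vanish. *)
Lemma logn_central_bin_leq p n : prime p -> 0 < n ->
  logn p 'C(n.*2, n) <= trunc_log p n.*2.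
Proof.
move=> pp n0; rewrite logn_central_bin //.
have p1 := prime_gt1 pp.
have lt_t : (trunc_log p n.*2).+1 <= n.*2.+1.
  by rewrite ltnS -ltnS (leq_trans (ltn_expl _ p1)) // (leq_trans (trunc_logP p1 _)) //; lia.
rewrite (@big_cat_nat _ _ _ (trunc_log p n.*2).+1) //=.
rewrite [X in _ + X]big_nat [X in _ + X]big1 ?addn0; last first.
  move=> k /andP[k1 k2]; rewrite divn_small //.
  by apply: leq_trans (trunc_log_ltn _ p1) _; rewrite leq_exp2l.
set t := trunc_log _ _; have {2}-> : t = \sum_(1 <= k < t.+1) 1.
  by rewrite sum_nat_const_nat muln1 subn1.
apply: leq_sum => k _; have pk : 0 < p ^ k by rewrite expn_gt0 prime_gt0.
move: (p ^ k) pk => d d0.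
have := divn_eq n d; have := ltn_pmod n d0; set a := n %/ d; set r := n %% d => lt_r ->.
have -> : (a * d + r).*2 = a.*2 * d + r.*2 by lia.
rewrite divnMDl // addKn -ltnS ltn_divLR //; lia.
Qed.

Lemma central_bin_part_leq p n : prime p -> 0 < n -> p ^ logn p 'C(n.*2, n) <= n.*2.
Proof.
move=> pp n0; apply: leq_trans (trunc_logP (prime_gt1 pp) _); last by lia.
by rewrite leq_exp2l ?prime_gt1 ?logn_central_bin_leq.
Qed.

(** Here p occurs once in n! and twice in (2n)!; moreover p >= 3, so p^2 >= 3p > 2n and higher
    powers contribute nothing. *)
Lemma logn_central_bin_mid p n : prime p -> 2 < n -> n.*2 < 3 * p -> p <= n ->
  logn p 'C(n.*2, n) = 0.
Proof.
move=> pp n2 lt_p le_p; rewrite logn_central_bin // big_nat big1 // => k /andP[k1 _].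
case: k k1 => [|[|k]] // _.
  have p0 := prime_gt0 pp; rewrite expn1 (_ : n = 1 * p + (n - p)); last by lia.
  rewrite (_ : (_ + _).*2 = 2 * p + (n - p).*2); last by lia.
  by rewrite !divnMDl // !divn_small; lia.
have p2 : 2 < p by lia.
have : 3 * p <= p ^ k.+2.
  by rewrite !expnS mulnA (leq_trans _ (leq_pmulr _ _)) ?expn_gt0 ?prime_gt0 ?leq_mul.
by move=> /(leq_trans lt_p) ?; rewrite divn_small.
Qed.

(** Primes up to [s] contribute at most 2n each. Those in (s, 2n/3] have exponent at most 1, so the
    primorial bound covers them. Those in (2n/3, n] do not occur, and those in (n, 2n] again
    contribute at most 2n each. *)
Lemma central_bin_upper n s : 2 < n -> n.*2 < s.+1 ^ 2 ->
  'C(n.*2, n) <= n.*2 ^ s * 4 ^ (n.*2 %/ 3) *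
    n.*2 ^ size [seq p <- index_iota n.+1 n.*2.+1 | prime p].
Proof.
move=> n2 lt_s; set B := 'C(_, _); have B0 : 0 < B by rewrite bin_gt0; lia.
pose t := n.*2 %/ 3.
have -> : B = \prod_(0 <= p < n.*2.+1 | prime p) p ^ logn p B.
  rewrite {1}[B]prod_prime_decomp // prime_decompE big_map /=.
  rewrite -[RHS]big_filter [RHS](bigID (mem (primes B))) /=.
  rewrite [X in _ = _ * X]big1_seq ?muln1; last first.
    move=> p /andP[np _]; move: np; rewrite -logn_gt0 -eqn0Ngt => /eqP->.
    exact: expn0.
  rewrite -[RHS]big_filter; apply: perm_big; apply: uniq_perm.
  - exact: primes_uniq.
  - by rewrite !filter_uniq ?iota_uniq.
  move=> p; rewrite !mem_filter mem_iota add1n ltnS.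
  case pB : (p \in primes B) => //=; apply/esym.
  move: (pB); rewrite mem_primes => /and3P[pp _ _]; rewrite pp prime_gt0 //=.
  have n0 : 0 < n by lia.
  have lp : 0 < logn p B by rewrite logn_gt0.
  apply: leq_trans (central_bin_part_leq pp n0).
  by rewrite -{1}[p]expn1 leq_pexp2l // prime_gt0.
apply: leq_trans (_ : \prod_(0 <= p < n.*2.+1 | prime p)
  ((if 0 < p <= s then n.*2 else 1) * (if p <= t then p else 1) *
     (if n < p then n.*2 else 1)) <= _).
  rewrite big_seq_cond [leqRHS]big_seq_cond; apply: leq_prod => p /andP[_ pp].
  have p0 := prime_gt0 pp; rewrite p0 /=.
  have le2n : p ^ logn p B <= n.*2 by apply: central_bin_part_leq; lia.
  have [le_s|lt_sp] := leqP p s.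
    by rewrite -mulnA (leq_trans le2n) // leq_pmulr // muln_gt0; do 2!case: ifP; lia.
  rewrite mul1n; have [le_t|lt_t] := leqP p t; last first.
    rewrite mul1n; case: ltnP => [//|le_n].
    rewrite logn_central_bin_mid // mulnC -ltn_divLR //.
  apply: leq_trans (_ : p * 1 <= _); last by rewrite leq_mul //; case: ifP; lia.
  rewrite muln1 -[leqRHS]expn1 leq_pexp2l // -ltnS -(@ltn_exp2l p) ?prime_gt1 //.
  apply: leq_ltn_trans le2n _; apply: leq_trans lt_s _; by rewrite leq_exp2r.
rewrite !big_split /= leq_mul ?leq_mul //.
- rewrite -big_mkcondr -big_filter big_const_seq count_predT iter_muln_1.
  rewrite leq_pexp2l //; first by lia.
  rewrite -[leqRHS](size_iota 1); apply: uniq_leq_size; first by rewrite filter_uniq ?iota_uniq.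
  by move=> p; rewrite mem_filter mem_iota add1n ltnS => /andP[/andP[]].
- apply: leq_trans (primorial_leq t).
  rewrite -big_mkcondr (@big_cat_nat _ _ _ t.+1) //=; last by rewrite ltnS leq_div.
  rewrite [X in _ * X]big_nat_cond [X in _ * X]big1 ?muln1; last by move=> p; lia.
  by rewrite big_nat_cond [leqRHS]big_nat_cond; apply/eq_leq/eq_bigl => p; lia.
rewrite -big_mkcondr (@big_cat_nat _ _ _ n.+1) //=; last by lia.
rewrite [X in X * _]big_nat_cond [X in X * _]big1 ?mul1n; last by move=> p; lia.
rewrite big_nat_cond -big_filter big_const_seq count_predT iter_muln_1.
rewrite leq_pexp2l //; first by lia.
by rewrite !size_filter; apply: sub_count => p /=; lia.
Qed.

(** Tuned for [primes_between_doubles]: with 2^k < 4n it gives 216 k^2 < n. The inequality fails at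
    k = 18. *)
Lemma sqr_leq_exp2 k : 19 <= k -> 864 * k ^ 2 <= 2 ^ k.
Proof.
move=> k19; rewrite -(subnK k19); elim: (k - 19) => [|j IHj]; first by lia.
rewrite addSn [2 ^ _]expnS; nia.
Qed.

Lemma primes_between_doubles n k : 2 ^ 18 <= n -> n.*2 <= 2 ^ k ->
  n <= k.*2 * size [seq p <- index_iota n.+1 n.*2.+1 | prime p].
Proof.
move=> n_ge le_k; set m := size _.
have n19 : 2 ^ 19 <= n.*2 by rewrite expnS mul2n leq_double.
have n0 : 0 < n by apply: leq_trans n_ge; rewrite expn_gt0.
(* The least exponent also satisfies 2^(k0 - 1) < 2n, which an arbitrary [k] need not. *)
pose k0 := up_log 2 n.*2.
have le_k0 : k0 <= k by apply: up_log_min.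
have k0_19 : 19 <= k0 by rewrite -(@leq_exp2l 2) // (leq_trans n19) // up_logP.
have lt_k0 : 2 ^ k0.-1 < n.*2 by apply: up_log_gtn => //; lia.
apply: (@leq_trans (k0.*2 * m)); last by rewrite leq_mul2r leq_double le_k0 orbT.
have [s /andP[s_le s_gt]] : exists s, s ^ 2 <= n.*2 < s.+1 ^ 2.
  have ex0 : exists i, i ^ 2 <= n.*2 by exists 0.
  have bnd i : i ^ 2 <= n.*2 -> i <= n.*2 by nia.
  by case: (ex_maxnP ex0 bnd) => s s1 s2; exists s; rewrite s1 ltnNge; apply/negP => /s2; lia.
have n2 : 2 < n by lia.
have := central_bin_upper n2 s_gt; rewrite -/m.
have := central_bin_lower n0.
set B := 'C(_, _) => low up.
(* Comparing exponents leaves 2n/3 <= k0 (s + m + 1). As s^2 <= 2n and 216 k0^2 < n, the part k0 (s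
   + 1) is at most n/6, so n/2 <= k0 m remains. *)
have : 2 ^ (n.*2) <= 2 ^ (k0 * (s + m).+1 + (n.*2 %/ 3).*2).
  rewrite -[X in 2 ^ X <= _]mul2n expnM (leq_trans low) //.
  rewrite (leq_trans (leq_mul (leqnn _) up)) //.
  rewrite expnD -[(_ %/ 3).*2]mul2n [2 ^ (2 * _)]expnM expnM.
  have -> a : a * (a ^ s * 4 ^ (n.*2 %/ 3) * a ^ m) = a ^ (s + m).+1 * 4 ^ (n.*2 %/ 3).
    by rewrite expnS expnD; lia.
  by rewrite leq_mul // leq_exp2r // up_logP.
rewrite leq_exp2l // => le1.
have := sqr_leq_exp2 k0_19.
have -> : 2 ^ k0 = (2 ^ k0.-1).*2 by rewrite -mul2n -expnS prednK //; lia.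
have := leq_divM n.*2 3.
nia.
Qed.

Local Open Scope ring_scope.

(** * Counting primes z with h p / z close to 0 *)

Lemma intr_Zp_eq0 q (m : int) : (1 < q)%N -> (m%:~R == 0 :> 'Z_q) = (q %| m)%Z.
Proof.
move=> q1; have natE n : (n%:R == 0 :> 'Z_q) = (q %| n)%N.
  by rewrite -val_eqE /= val_Zp_nat.
case: m => n; first by rewrite -pmulrn natE.
by rewrite NegzE mulrNz oppr_eq0 -pmulrn natE /= dvdzE abszN.
Qed.

(** For q > 1 this is the representative in (-q/2, q/2], so that [circ_dist u] is the distance ||u||
    to the nearest multiple of q. *)
Definition srep q (u : 'Z_q) : int := if (u <= q - u)%N then u%:Z else u%:Z - q%:Z.
Definition circ_dist q (u : 'Z_q) : nat := `|srep u|%N.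

Arguments srep {q} u%_R.
Arguments circ_dist {q} u%_R.

Section Srep.
Variables (q : nat) (q1 : (1 < q)%N).
Implicit Types u : 'Z_q.

Lemma ltn_Zp u : (u < q)%N.
Proof. by have := ltn_ord u; rewrite [X in (_ < X)%N](Zp_cast q1). Qed.

Lemma srepK u : (srep u)%:~R = u.
Proof.
rewrite /srep; case: ifP => _; first by rewrite -pmulrn natr_Zp.
by rewrite rmorphB /= -!pmulrn natr_Zp pchar_Zp // subr0.
Qed.

Lemma circ_distE u : circ_dist u = minn u (q - u).
Proof.
by rewrite /circ_dist /srep; have := ltn_Zp u; case: ifP; lia.
Qed.

Lemma circ_dist_half u : ((circ_dist u).*2 <= q)%N.
Proof. by rewrite circ_distE; have := ltn_Zp u; lia. Qed.

Lemma circ_dist_gt0 u : u != 0 -> (0 < circ_dist u)%N.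
Proof.
move=> u0; have : (0 < u)%N by rewrite lt0n.
by have := ltn_Zp u; rewrite circ_distE; lia.
Qed.

Lemma unit_Zp_coprime n : coprime q n -> (n%:R : 'Z_q) \is a GRing.unit.
Proof. by rewrite unitZpE. Qed.

End Srep.

(** If j represents h z / p, then j p = [srep h] z + i q for some integer i, and |j| <=
    [circ_dist h] forces |i| <= [K]. Each of these 2K + 1 values has at most three prime divisors in
    [Z]. *)
Lemma count_close_multiples q N (Z : seq nat) z (h : 'Z_q) :
  (1 < q)%N -> (q <= N.+1 ^ 3)%N -> uniq Z -> all prime Z ->
  {in Z, forall p, (N < p <= N.*2)%N} -> {in Z, forall p, coprime q p} ->
  (0 < z <= N.*2)%N -> coprime q z -> h != 0 ->
  (q * count (fun p : nat => circ_dist (h * z%:R / p%:R) <= circ_dist h) Z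
    <= 3 * (8 * N * circ_dist h + q))%N.
Proof.
move=> q1 leqN uZ prZ rZ copZ /andP[z0 zN] copz h0.
set d := circ_dist h; set K := (4 * N * d %/ q)%N; set P := (fun p : nat => _).
pose n (i : 'I_(K.*2.+1)) : int := srep h * z%:Z + q%:Z * (i%:Z - K%:Z).
pose j (p : nat) : int := srep (h * z%:R / p%:R).
pose P' i (p : nat) := P p && (j p * p%:Z == n i).
have dhalf := circ_dist_half q1 h; rewrite -/d in dhalf.
have cnt i : (count (P' i) Z <= 3)%N.
  (* The size of [n i] is read off a prime that is counted, if there is one: |n i| = |j p| p <= 2 N
     d <= N q < (N + 1)^4. *)
  have [/hasP[p pZ /andP[Pp /eqP jpE]]|] := boolP (has (P' i) Z); last first.
    by rewrite has_count -leqNgt leqn0 => /eqP->.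
  apply: (@leq_trans (count (dvdn^~ `|n i|%N) Z)).
    apply: sub_count => x /andP[_ /eqP <-].
    by rewrite abszM dvdn_mull.
  apply: (@count_prime_divisors _ N) => //; first by move=> x /rZ /andP[].
  rewrite absz_gt0; apply/andP; split.
    apply: contraNneq h0 => n0.
    have : (n i)%:~R = 0 :> 'Z_q by rewrite n0.
    rewrite rmorphD !rmorphM /= srepK // -!pmulrn pchar_Zp // mul0r addr0.
    by move=> hz; rewrite -(mulrK (unit_Zp_coprime q1 copz) h) hz mul0r.
  have {}Pp : (`|j p| <= d)%N by [].
  have /andP[_ p2] := rZ _ pZ.
  rewrite -jpE abszM absz_nat; apply: (@leq_ltn_trans (d * N.*2)); first exact: leq_mul.
  rewrite (_ : d * N.*2 = N * d.*2)%N; last by lia.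
  apply: (@leq_ltn_trans (N * N.+1 ^ 3)); first by rewrite leq_mul // (leq_trans dhalf).
  by rewrite [(_ ^ 4)%N]expnS ltn_mul2r expn_gt0 /=.
have cover p : p \in Z -> P p -> (0 < \sum_(i < K.*2.+1) P' i p)%N.
  move=> pZ Pp; have {}Pp' : (`|j p| <= d)%N by [].
  have /andP[_ p2] := rZ _ pZ.
  have /dvdzP[i0 i0E] : (q %| j p * p%:Z - srep h * z%:Z)%Z.
    rewrite -intr_Zp_eq0 // rmorphB !rmorphM /= !srepK // -!pmulrn.
    by rewrite divrK ?subrr // unit_Zp_coprime // copZ.
  have i0le : (`|i0| <= K)%N.
    rewrite leq_divRL; last by lia.
    have tri (a b : int) : (absz (a - b)%R <= absz a + absz b)%N by lia.
    rewrite -[X in (_ * X)%N](absz_nat q) -abszM -i0E.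
    apply: leq_trans (tri _ _) _; rewrite !abszM !absz_nat -[`|srep h|%N]/d.
    have : (`|j p| * p <= d * N.*2)%N by apply: leq_mul.
    have : (d * z <= d * N.*2)%N by apply: leq_mul.
    lia.
  have lt_i : (absz (i0 + K%:Z)%R < K.*2.+1)%N by lia.
  rewrite (bigD1 (Ordinal lt_i)) //= /P' Pp /= (_ : _ == _) //.
  rewrite /n /= gez0_abs; last by lia.
  by rewrite addrK [q%:Z * _]mulrC -i0E addrC subrK.
have le1 : (count P Z <= \sum_(i < K.*2.+1) count (P' i) Z)%N.
  under eq_bigr do rewrite -sum1_count big_mkcond /=.
  rewrite exchange_big /= -sum1_count big_mkcond big_seq [leqRHS]big_seq.
  by apply: leq_sum => p pZ; case: ifP => // /(cover p pZ).
have le2 : (\sum_(i < K.*2.+1) count (P' i) Z <= K.*2.+1 * 3)%N.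
  by rewrite -[X in (_ <= X * _)%N]card_ord -sum_nat_const leq_sum.
have := leq_divM (4 * N * d) q; rewrite -/K; nia.
Qed.

(** * Fourier analysis on Z/q *)

(** Each dyadic block of denominators from 2^k to 2^(k+1) - 1 adds at most 1. *)
Lemma harmonic_leq (K : numFieldType) k :
  \sum_(0 <= i < 2 ^ k - 1) (i.+1%:R)^-1 <= k%:R :> K.
Proof.
elim: k => [|k IHk]; first by rewrite big_nil.
have p0 : (0 < 2 ^ k)%N by rewrite expn_gt0.
rewrite (@big_cat_nat _ _ _ (2 ^ k - 1)) ?expnS //=; try lia.
rewrite -[k.+1]addn1 natrD lerD //.
apply: (@le_trans _ _ (\sum_(2 ^ k - 1 <= i < 2 * 2 ^ k - 1) ((2 ^ k)%:R)^-1)).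
  rewrite big_nat_cond [leRHS]big_nat_cond; apply: ler_sum => i /andP[/andP[i1 i2] _].
  by rewrite lef_pV2 ?posrE ?ltr0n // ler_nat; lia.
rewrite sumr_const_nat -[leLHS]mulr_natl (_ : (_ - _)%N = (2 ^ k)%N); last by lia.
by rewrite divff // pnatr_eq0; lia.
Qed.

Section Fourier.
Variables (C : numClosedFieldType) (q : nat) (w : C).
Hypotheses (q1 : (1 < q)%N) (prim : q.-primitive_root w).

Definition chi (u : 'Z_q) : C := w ^+ u.

Lemma chi_nat n : chi n%:R = w ^+ n.
Proof. by rewrite /chi val_Zp_nat // (prim_expr_mod prim). Qed.

Lemma chiD u v : chi (u + v) = chi u * chi v.
Proof. by rewrite -[u]natr_Zp -[v]natr_Zp -natrD !chi_nat exprD. Qed.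

Lemma chi0 : chi 0 = 1. Proof. by rewrite /chi expr0. Qed.

Lemma norm_chi u : `|chi u| = 1.
Proof.
rewrite normrX; apply/eqP; rewrite -(@pexpr_eq1 _ _ q); last 2 first.
- by rewrite ltnW.
- by rewrite exprn_ge0.
by rewrite -exprM mulnC exprM -normrX (prim_expr_order prim) normr1 expr1n.
Qed.

Lemma conj_chi u : (chi u)^* = chi (- u).
Proof.
have nz : chi u != 0 by rewrite -normr_eq0 norm_chi oner_eq0.
apply: (mulfI nz); rewrite -normCK norm_chi expr1n -chiD subrr chi0 //.
Qed.

Lemma chi_eq1 u : (chi u == 1) = (u == 0).
Proof.
rewrite /chi -(prim_order_dvd prim) -val_eqE /=.
case: posnP => [->|u0]; first by rewrite dvdn0.
by rewrite gtnNdvd ?ltn_Zp //; lia.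
Qed.

(** Translating [t] by 1 multiplies the sum by [chi u], which differs from 1 unless [u] is 0. *)
Lemma sum_chi u : \sum_t chi (u * t) = if u == 0 then q%:R else 0.
Proof.
case: eqP => [->|/eqP u0].
  under eq_bigr do rewrite mul0r chi0.
  by rewrite sumr_const card_ord Zp_cast.
apply/eqP; have : (chi u - 1) * \sum_t chi (u * t) == 0; last first.
  by rewrite mulf_eq0 subr_eq0 chi_eq1 (negPf u0).
rewrite mulrBl mul1r subr_eq0 mulr_sumr; apply/eqP.
rewrite [RHS](reindex_inj (addrI 1)) /=; apply: eq_bigr => t _.
by rewrite mulrDr mulr1 chiD.
Qed.

Definition dft (f : 'Z_q -> C) u := \sum_t f t * chi (u * t).

Lemma parseval f : \sum_u `|dft f u| ^+ 2 = q%:R * \sum_t `|f t| ^+ 2.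
Proof.
transitivity (\sum_u \sum_t \sum_s f t * (f s)^* * chi (u * (t - s))).
  apply: eq_bigr => u _; rewrite normCK /dft rmorph_sum big_distrlr /=.
  apply: eq_bigr => t _; apply: eq_bigr => s _.
  by rewrite rmorphM /= conj_chi mulrBr chiD mulrACA.
rewrite exchange_big mulr_sumr; apply: eq_bigr => t _.
rewrite exchange_big /= (bigD1 t) //= [X in _ + X]big1 ?addr0.
  rewrite -mulr_sumr; under eq_bigr do rewrite subrr mulrC.
  by rewrite sum_chi eqxx normCK mulrC.
move=> s ts; rewrite -mulr_sumr; under eq_bigr do rewrite mulrC.
by rewrite sum_chi subr_eq0 eq_sym (negPf ts) mulr0.
Qed.

(* Parseval for q F - dft F 0, whose transform vanishes at 0 and is q (dft F) elsewhere. *)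
Lemma zeros_leq_dft (F : 'Z_q -> C) :
  #|[set t | F t == 0]|%:R * `|dft F 0| ^+ 2 <= q%:R * \sum_(u | u != 0) `|dft F u| ^+ 2.
Proof.
pose f t := q%:R * F t - dft F 0.
have dftf u : dft f u = if u == 0 then 0 else q%:R * dft F u.
  rewrite /dft; under eq_bigr do rewrite mulrBl -mulrA.
  rewrite sumrB -!mulr_sumr sum_chi; case: eqP => [->|_]; last by rewrite mulr0 subr0.
  by rewrite [X in X - _]mulrC subrr.
have q0 : 0 < q%:R :> C by rewrite ltr0n ltnW.
have := parseval f; rewrite (bigD1 0) //= dftf eqxx normr0 expr0n add0r => pars.
have {pars} : q%:R * (q%:R * \sum_(u | u != 0) `|dft F u| ^+ 2) = q%:R * \sum_t `|f t| ^+ 2.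
  rewrite -pars mulrA mulr_sumr; apply: eq_bigr => u u0.
  by rewrite dftf (negPf u0) normrM exprMn normr_nat expr2.
move/(mulfI (lt0r_neq0 q0)) => ->.
rewrite mulr_natl -sumr_const.
rewrite [leRHS](bigID (mem [set t | F t == 0])) /= -[leLHS]addr0 lerD //; last first.
  by apply: sumr_ge0 => t _; rewrite exprn_ge0.
by apply: ler_sum => t; rewrite inE /f => /eqP ->; rewrite mulr0 sub0r normrN.
Qed.


(** * The Fejer kernel *)

Section Kernel.
Variables (L : nat) (leLq : (L <= q)%N).

Definition geom (u : 'Z_q) : C := \sum_(i < L) chi (u * i%:R).
Definition fejer u : C := `|geom u| ^+ 2.

Lemma fejer_ge0 u : 0 <= fejer u. Proof. exact: exprn_ge0. Qed.

Lemma fejer_leq u : fejer u <= (L ^ 2)%:R.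
Proof.
rewrite natrX lerXn2r ?nnegrE ?normr_ge0 ?ler0n //.
apply: le_trans (ler_norm_sum _ _ _) _.
by under eq_bigr do rewrite norm_chi //; rewrite sumr_const card_ord.
Qed.

(** Parseval for the indicator function of the residues below [L], which are distinct because L <=
    q. *)
Lemma sum_fejer : \sum_u fejer u = (q * L)%:R.
Proof.
pose f (t : 'Z_q) : C := (t < L)%N%:R.
have widen (F : nat -> C) : \sum_(i < L) F i = \sum_(t : 'Z_q | (t < L)%N) F t.
  by apply: big_ord_widen; rewrite Zp_cast.
have dftf u : geom u = dft f u.
  rewrite /geom (widen (fun i => chi (u * i%:R))) big_mkcond; apply: eq_bigr => t _.
  by rewrite /f natr_Zp; case: ifP; rewrite ?mul1r ?mul0r.
under eq_bigr do rewrite /fejer dftf.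
rewrite parseval natrM; congr (_ * _).
have -> : L%:R = \sum_(i < L) (1 : C) by rewrite sumr_const card_ord.
rewrite (widen (fun=> 1)) [RHS]big_mkcond; apply: eq_bigr => t _.
by rewrite /f; case: ifP; rewrite ?normr1 ?normr0 ?expr1n ?expr0n.
Qed.

(** An arbitrary primitive root need not satisfy this bound, as its powers may go round the circle
    in another order; the root e(1/q) is shown below to satisfy it. *)
Hypothesis chord : forall u, u != 0 -> (circ_dist u).*2%:R <= q%:R * `|1 - chi u|.

(** The geometric sum telescopes against [1 - chi u], so the product has modulus at most 2, and the
    chord bound converts [1 - chi u] into ||u||. *)
Lemma fejer_decay u : u != 0 -> (circ_dist u ^ 2)%:R * fejer u <= (q ^ 2)%:R.
Proof.
move=> u0; rewrite /fejer !natrX -exprMn lerXn2r ?nnegrE ?mulr_ge0 ?ler0n //.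
have le2 : `|geom u| * `|1 - chi u| <= 2.
  have tele n : (\sum_(i < n) chi (u * i%:R)) * (1 - chi u) = 1 - chi (u * n%:R).
    elim: n => [|n IHn]; first by rewrite big_ord0 mul0r mulr0 chi0 subrr.
    rewrite big_ord_recr mulrDl IHn /= (_ : u * n.+1%:R = u * n%:R + u).
      rewrite chiD; ring.
    by rewrite -natr1 mulrDr mulr1.
  rewrite -normrM tele.
  by apply: le_trans (ler_normB _ _) _; rewrite normr1 norm_chi.
rewrite -(@ler_pM2l _ 2) // mulrA -natrM mul2n.
apply: le_trans (ler_wpM2r (normr_ge0 _) (chord u0)) _.
by rewrite mulrAC -mulrA [2 * _]mulrC ler_wpM2l.
Qed.

(** By decay each term is at most q^2 / ||u||, and 1 / ||u|| <= 1/u + 1/(q - u) splits the sum into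
    two harmonic sums, each at most k. *)
Lemma sum_fejer_dist k : (q <= 2 ^ k)%N ->
  \sum_(u | u != 0) (circ_dist u)%:R * fejer u <= (q ^ 2 * k.*2)%:R.
Proof.
move=> leqk.
apply: (@le_trans _ _ (\sum_(u : 'Z_q | u != 0) (q ^ 2)%:R * ((u%:R)^-1 + ((q - u)%N%:R)^-1))).
  apply: ler_sum => u u0; have d0 := circ_dist_gt0 q1 u0.
  have d0' : 0 < (circ_dist u)%:R :> C by rewrite ltr0n.
  have le1 : (circ_dist u)%:R * fejer u <= (q ^ 2)%:R * (circ_dist u)%:R^-1.
    by rewrite ler_pdivlMr // mulrAC -natrM mulnn; exact: fejer_decay.
  apply: le_trans le1 _; rewrite ler_wpM2l ?ler0n // circ_distE //.
  have ltu := ltn_Zp q1 u.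
  by rewrite /minn; case: ifP => _; rewrite ?lerDl ?lerDr invr_ge0 ler0n.
have toNat (G : nat -> C) : \sum_(u : 'Z_q | u != 0) G u = \sum_(0 <= i < q.-1) G i.+1.
  rewrite -(big_mkord (fun i => i != 0%N) G) Zp_cast // big_ltn_cond ?(ltnW q1) //=.
  rewrite -[in LHS](prednK (ltnW q1)) big_add1 /= big_mkcond.
  by apply: eq_bigr.
have harm : \sum_(0 <= i < q.-1) (i.+1%:R)^-1 <= k%:R :> C.
  apply: le_trans (harmonic_leq _ k).
  rewrite [leRHS](@big_cat_nat _ _ _ q.-1) //=; last by lia.
  by rewrite lerDl sumr_ge0 // => i _; rewrite invr_ge0 ler0n.
rewrite -mulr_sumr natrM ler_wpM2l ?ler0n // big_split /= -addnn natrD lerD //.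
  by rewrite (toNat (fun i => i%:R^-1)).
rewrite (toNat (fun i => (q - i)%N%:R^-1)) big_nat_rev /=.
rewrite big_nat_cond (eq_bigr (fun i => i.+1%:R^-1)) -?big_nat_cond // => i.
by case/andP=> /andP[_ lti] _; congr (_%:R^-1); lia.
Qed.

(** * The dispersion estimate for products with primes of Z *)

Section Dispersion.
Variables (N k : nat) (Z : seq nat).
Hypotheses (leqN : (q <= N.+1 ^ 3)%N) (leqk : (q <= 2 ^ k)%N).
Hypotheses (uZ : uniq Z) (prZ : all prime Z).
Hypotheses (rZ : {in Z, forall p, (N < p <= N.*2)%N}).
Hypotheses (copZ : {in Z, forall p, coprime q p}).

(** Substituting h = u p, a bijection on nonzero residues since p is a unit, turns the condition
    into ||h z / p|| <= ||h||. For fixed z and h, [count_close_multiples] bounds the number of p;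
    summing over h uses [sum_fejer_dist] and [sum_fejer]. *)
Lemma sum_fejer_close :
  q%:R * \sum_(u : 'Z_q | u != 0) \sum_(z <- Z) \sum_(p <- Z)
     (circ_dist (u * z%:R) <= circ_dist (u * p%:R))%N%:R * fejer (u * p%:R)
  <= (size Z * (3 * q ^ 2 * (16 * N * k + L)))%:R.
Proof.
rewrite exchange_big /= mulr_sumr.
have -> : (size Z * (3 * q ^ 2 * (16 * N * k + L)))%:R =
    \sum_(z <- Z) (3 * q ^ 2 * (16 * N * k + L))%:R :> C.
  by rewrite big_const_seq count_predT iter_addr_0 natrM mulr_natl.
rewrite big_seq [leRHS]big_seq; apply: ler_sum => z zZ.
rewrite exchange_big /=.
have -> : \sum_(p <- Z) \sum_(u : 'Z_q | u != 0)
     (circ_dist (u * z%:R) <= circ_dist (u * p%:R))%N%:R * fejer (u * p%:R) =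
  \sum_(p <- Z) \sum_(h : 'Z_q | h != 0)
     (circ_dist (h * z%:R / p%:R) <= circ_dist h)%N%:R * fejer h.
  rewrite big_seq [RHS]big_seq; apply: eq_bigr => p pZ.
  have up := unit_Zp_coprime q1 (copZ pZ).
  rewrite [RHS](reindex_inj (mulIr up)) /=; apply: eq_big => [u|u _].
    by rewrite mulIr_eq0 //; exact: mulIr.
  by rewrite mulrAC mulrK.
rewrite exchange_big /= mulr_sumr.
apply: (@le_trans _ _ (\sum_(h : 'Z_q | h != 0) (3 * (8 * N * circ_dist h + q))%:R * fejer h)).
  apply: ler_sum => h h0; rewrite -mulr_suml mulrA ler_wpM2r ?fejer_ge0 //.
  rewrite -natr_sum -natrM ler_nat.
  have -> : (\sum_(p <- Z) (circ_dist (h * z%:R / p%:R)%R <= circ_dist h) =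
    count (fun p : nat => circ_dist (h * z%:R / p%:R)%R <= circ_dist h) Z)%N.
    by rewrite -sum1_count [RHS]big_mkcond; apply: eq_bigr => p _; case: ifP.
  have /andP[z1 z2] := rZ zZ.
  by apply: (@count_close_multiples q N Z z h) => //; [rewrite z2 andbT; lia | exact: copZ].
apply: (@le_trans _ _ (3 * (8 * N%:R * (q ^ 2 * k.*2)%:R + q%:R * (q * L)%:R))); last first.
  by rewrite -!natrM -natrD -natrM ler_nat; lia.
rewrite -sum_fejer (eq_bigr (fun h : 'Z_q =>
    3 * (8 * N%:R * ((circ_dist h)%:R * fejer h) + q%:R * fejer h))); last first.
  by move=> h _; rewrite natrM natrD !natrM; ring.
rewrite -mulr_sumr ler_wpM2l // big_split /= lerD //.
  rewrite -mulr_sumr ler_wpM2l ?mulr_ge0 ?ler0n //.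
  exact: sum_fejer_dist.
rewrite -mulr_sumr ler_wpM2l ?ler0n // [leRHS](bigD1 0) //= lerDr; exact: fejer_ge0.
Qed.

(** In each product of the expanded square, the factor at the smaller distance is bounded by L^2 and
    the other is kept; symmetry in z and p gives the factor 2. *)
Lemma sum_fejer_sqr :
  q%:R * \sum_(u : 'Z_q | u != 0) (\sum_(z <- Z) fejer (u * z%:R)) ^+ 2
  <= (6 * L ^ 2 * size Z * q ^ 2 * (16 * N * k + L))%:R.
Proof.
set T := \sum_(u : 'Z_q | u != 0) \sum_(z <- Z) \sum_(p <- Z)
     (circ_dist (u * z%:R) <= circ_dist (u * p%:R))%N%:R * fejer (u * p%:R).
apply: (@le_trans _ _ (2 * (L ^ 2)%:R * (q%:R * T))); last first.
  apply: le_trans (ler_wpM2l _ sum_fejer_close) _; first by rewrite mulr_ge0 ?ler0n.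
  by rewrite -!natrM ler_nat; lia.
rewrite mulrCA ler_wpM2l ?ler0n // /T mulr_sumr; apply: ler_sum => u u0.
pose b z := fejer (u * z%:R); pose d (z : nat) := circ_dist (u * z%:R).
pose S := \sum_(z <- Z) \sum_(p <- Z) (d z <= d p)%N%:R * b p.
rewrite -[leRHS]/(2 * (L ^ 2)%:R * S).
apply: (@le_trans _ _ (\sum_(z <- Z) \sum_(p <- Z) (L ^ 2)%:R *
    ((d z <= d p)%N%:R * b p + (d p <= d z)%N%:R * b z))).
  rewrite expr2 big_distrlr /=; apply: ler_sum => z _; apply: ler_sum => p _.
  have bz : b z <= (L ^ 2)%:R by exact: fejer_leq.
  have bp : b p <= (L ^ 2)%:R by exact: fejer_leq.
  have bz0 : 0 <= b z by exact: fejer_ge0.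
  have bp0 : 0 <= b p by exact: fejer_ge0.
  have L0 : 0 <= (L ^ 2)%:R :> C by rewrite ler0n.
  rewrite -/(b z) -/(b p); have [le1|lt1] := leqP (d z) (d p).
    apply: (@le_trans _ _ ((L ^ 2)%:R * b p)); first by rewrite ler_wpM2r.
    by rewrite ler_wpM2l // mul1r lerDl mulr_ge0 ?ler0n.
  rewrite (ltnW lt1) mul0r add0r mul1r mulrC ler_wpM2r //.
have -> : \sum_(z <- Z) \sum_(p <- Z) (L ^ 2)%:R *
    ((d z <= d p)%N%:R * b p + (d p <= d z)%N%:R * b z) = 2 * (L ^ 2)%:R * S.
  under eq_bigr do rewrite -mulr_sumr big_split /=.
  rewrite -mulr_sumr big_split /= -/S [X in S + X]exchange_big /= -/S; ring.
exact: lexx.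
Qed.

(** Writing y as s + i + j makes its exponential sum a square of [geom], whose modulus is exactly
    [fejer]. The bound then follows from [zeros_leq_dft] and [sum_fejer_sqr]. *)
Lemma unreached_leq s :
  (#|[set t : 'Z_q | [forall i : 'I_L, forall j : 'I_L,
       all (fun z : nat => t != (z%:R * (s + i + j)%:R)%R) Z]]| * (size Z * L ^ 2) ^ 2
   <= 6 * L ^ 2 * size Z * q ^ 2 * (16 * N * k + L))%N.
Proof.
pose F (t : 'Z_q) : C := \sum_(z <- Z) \sum_(i < L) \sum_(j < L) (t == z%:R * (s + i + j)%:R :> 'Z_q)%:R.
have dftF u : dft F u = \sum_(z <- Z) chi (u * z%:R * s%:R) * geom (u * z%:R) ^+ 2.
  rewrite /dft /F; under eq_bigr do rewrite mulr_suml.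
  rewrite exchange_big; apply: eq_bigr => z _ /=.
  under eq_bigr do rewrite mulr_suml.
  rewrite exchange_big expr2 big_distrlr mulr_sumr; apply: eq_bigr => i _ /=.
  under eq_bigr do rewrite mulr_suml.
  rewrite exchange_big mulr_sumr; apply: eq_bigr => j _ /=.
  rewrite (bigD1 (z%:R * (s + i + j)%:R)) //= eqxx mul1r big1 ?addr0; last first.
    by move=> t /negPf ->; rewrite mul0r.
  by rewrite -!chiD !natrD !mulrDr !mulrA addrA.
have dft0 : dft F 0 = (size Z * L ^ 2)%:R.
  rewrite dftF (eq_bigr (fun _ => (L ^ 2)%:R)).
    by rewrite big_const_seq count_predT iter_addr_0 natrM mulr_natl.
  move=> z _; rewrite !mul0r chi0 mul1r natrX; congr (_ ^+ 2).
  by rewrite /geom; under eq_bigr do rewrite mul0r chi0; rewrite sumr_const card_ord.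
have dft_le u : `|dft F u| <= \sum_(z <- Z) fejer (u * z%:R).
  rewrite dftF; apply: le_trans (ler_norm_sum _ _ _) _; apply: ler_sum => z _.
  by rewrite normrM norm_chi // mul1r normrX.
rewrite -(ler_nat C) natrM; apply: le_trans sum_fejer_sqr.
apply: (@le_trans _ _ (q%:R * \sum_(u | u != 0) `|dft F u| ^+ 2)); last first.
  rewrite ler_wpM2l ?ler0n //; apply: ler_sum => u _.
  by rewrite lerXn2r ?nnegrE ?normr_ge0 ?sumr_ge0 // => z _; exact: fejer_ge0.
apply: le_trans (zeros_leq_dft F); rewrite dft0 normr_nat natrX ler_wpM2r ?exprn_ge0 ?ler0n //.
rewrite ler_nat; apply: subset_leq_card; apply/subsetP => t; rewrite !inE => /forallP unr.
rewrite /F big_seq big1 // => z zZ; rewrite big1 // => i _; rewrite big1 // => j _.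
by have /forallP/(_ j)/allP/(_ z zZ)/negPf -> := unr i.
Qed.

End Dispersion.
End Kernel.
End Fourier.

(** * A root of unity with the chord bound *)

Lemma norm_1subX_leq (C : numDomainType) (z : C) m : `|z| = 1 -> `|1 - z ^+ m| <= m%:R * `|1 - z|.
Proof.
move=> nz; elim: m => [|m IHm]; first by rewrite expr0 subrr normr0 mul0r.
have -> : 1 - z ^+ m.+1 = (1 - z ^+ m) + z ^+ m * (1 - z) by rewrite exprSr; ring.
apply: le_trans (ler_normD _ _) _; rewrite -natr1 mulrDl mul1r lerD //.
by rewrite normrM normrX nz expr1n mul1r.
Qed.

Section Cis.
Variable R : realType.
Implicit Types x y : R.

Definition cis x : R[i] := Complex (cos x) (sin x).

Lemma cisD x y : cis (x + y) = cis x * cis y.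
Proof. by rewrite /cis cosD sinD; congr Complex; rewrite addrC. Qed.

Lemma cisX x n : cis x ^+ n = cis (x *+ n).
Proof.
elim: n => [|n IHn]; first by rewrite expr0 mulr0n /cis cos0 sin0.
by rewrite exprS IHn mulrS cisD.
Qed.

Lemma norm_cis x : `|cis x| = 1.
Proof. by rewrite normc_def /= cos2Dsin2 sqrtr1. Qed.

Lemma cos_le0 x : pi / 2 <= x <= 3 * pi / 2 -> cos x <= 0.
Proof.
move=> /andP[x1 x2]; rewrite -[x](subrK pi) cosDpi oppr_le0 cos_ge0_pihalf //.
by apply/andP; split; lra.
Qed.

Lemma norm_1sub_cis_ge1 x : pi / 2 <= x <= 3 * pi / 2 -> 1 <= `|1 - cis x|.
Proof.
move=> /cos_le0 cx; apply: le_trans (normc_ge_Re _).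
rewrite lecR /=; apply: le_trans (ler_norm _); lra.
Qed.

(** A power z^m in the left half-plane gives 1 <= |1 - z^m| <= m |1 - z|, and 2 h m <= q
    finishes. *)
Lemma norm_1sub_cis_lb q h : (0 < h)%N -> (h.*2 <= q)%N ->
  h.*2%:R <= q%:R * `|1 - cis (2 * pi / q%:R *+ h)|.
Proof.
move=> h0 hq; set z := cis _.
(* m is chosen so that the angle of z ^+ m lies in [pi / 2, 3 pi / 2]. *)
pose m := ((q - 1) %/ (4 * h)).+1.
have m1 : (q <= 4 * (m * h))%N by have := ltn_ceil (q - 1) (_ : 0 < 4 * h)%N; nia.
have m2 : (4 * (m * h) < q + 4 * h)%N by have := leq_divM (q - 1) (4 * h); nia.
(* If 4h <= q then 4 m h < q + 4h <= 2q; otherwise m = 1 and this is the hypothesis on h. *)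
have m3 : (h.*2 * m <= q)%N.
  have [le4|lt4] := leqP (4 * h) q; first by nia.
  by rewrite /m divn_small; lia.
have q0 : 0 < q%:R :> R by rewrite ltr0n; lia.
have pi0 := pi_gt0 R.
have ge1 : 1 <= `|1 - z ^+ m|.
  rewrite /z cisX -mulrnA; apply: norm_1sub_cis_ge1.
  rewrite -[_ *+ (h * m)]mulr_natr mulrAC.
  have n1 : q%:R <= 4 * (h * m)%:R :> R by rewrite -natrM ler_nat; lia.
  have n2 : 4 * (h * m)%:R <= 3 * q%:R :> R by rewrite -!natrM ler_nat; lia.
  by rewrite ler_pdivlMr // ler_pdivrMr //; apply/andP; split; nra.
have : `|1 - z ^+ m| <= m%:R * `|1 - z| by apply: norm_1subX_leq; exact: norm_cis.
move=> /(le_trans ge1) ge1'.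
apply: (@le_trans _ _ (h.*2%:R * (m%:R * `|1 - z|))).
  by rewrite -[leLHS]mulr1 ler_wpM2l ?ler0n.
by rewrite mulrA -natrM ler_wpM2r // ler_nat.
Qed.

Lemma exists_chord_root q : (1 < q)%N -> exists w : R[i], q.-primitive_root w /\
  forall u : 'Z_q, u != 0 -> (circ_dist u).*2%:R <= q%:R * `|1 - chi w u|.
Proof.
move=> q1; pose w := cis (2 * pi / q%:R).
have q0 : q%:R != 0 :> R by rewrite pnatr_eq0; lia.
have wq : w ^+ q = 1.
  by rewrite /w cisX -[_ *+ q]mulr_natr divfK // mulr_natl /cis cos2pi sin2pi.
have nw : `|w| = 1 by exact: norm_cis.
have w0 : w != 0 by rewrite -normr_eq0 nw oner_eq0.
have chord h : (0 < h < q)%N -> (minn h (q - h)).*2%:R <= q%:R * `|1 - w ^+ h|.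
  move=> /andP[h0 hq]; rewrite /minn; case: ifP => hle.
    by rewrite /w cisX; apply: norm_1sub_cis_lb; lia.
  have -> : `|1 - w ^+ h| = `|1 - w ^+ (q - h)|.
    transitivity (`|w ^+ h| * `|1 - w ^+ (q - h)|); last by rewrite normrX nw expr1n mul1r.
    by rewrite -normrM mulrBr mulr1 -exprD subnKC ?(ltnW hq) // wq distrC.
  by rewrite /w cisX; apply: norm_1sub_cis_lb; lia.
(* Primitivity also follows from the chord bound: w^h = 1 with 0 < h < q would make a positive
   distance at most 0. *)
exists w; split.
  rewrite /primitive_root_of_unity ltnW //=; apply/forallP => i; rewrite unity_rootE.
  have [->|ne] := eqVneq i.+1 q; first by rewrite wq eqxx.
  have lt_i : (i.+1 < q)%N by rewrite ltn_neqAle ne ltn_ord.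
  rewrite (_ : (_ == 1) = false) //; apply/eqP => w1.
  have := chord i.+1 lt_i; rewrite w1 subrr normr0 mulr0 (ler_nat _ _ 0); lia.
move=> u u0; rewrite circ_distE // /chi; apply: chord.
by rewrite ltn_Zp // andbT lt0n.
Qed.

End Cis.

(** * The trilinear congruence *)

(** The residues (a x)^-1 are distinct, since x <= 2N < q, and more numerous than the unreached
    ones; so one of them equals some z (s + i + j). *)
Lemma trilinear_congruence (R : realType) (q N k L s : nat) (X Z : seq nat) (a : 'Z_q) :
  (1 < q)%N -> (N.*2 < q <= 2 ^ k)%N -> (q <= N.+1 ^ 3)%N -> (0 < L <= q)%N ->
  uniq X -> {in X, forall x, (x <= N.*2)%N /\ coprime q x} ->
  uniq Z -> all prime Z -> {in Z, forall p, (N < p <= N.*2)%N} ->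
  {in Z, forall p, coprime q p} -> a \is a GRing.unit ->
  (6 * q ^ 2 * (16 * N * k + L) < size X * size Z * L ^ 2)%N ->
  exists x z i j, [/\ x \in X, z \in Z, (i < L)%N, (j < L)%N & a * (x * z * (s + i + j))%:R = 1].
Proof.
move=> q1 /andP[Nq qk] qN /andP[L0 Lq] uX rX uZ prZ rZ copZ ua big.
have [w [prim chord]] := exists_chord_root R q1.
pose U := [set t : 'Z_q | [forall i : 'I_L, forall j : 'I_L,
       all (fun z : nat => t != (z%:R * (s + i + j)%:R)%R) Z]].
have := unreached_leq q1 prim Lq chord qN qk uZ prZ rZ copZ s; rewrite -/U => leU.
have ltU : (#|U| < size X)%N.
  have Z0 : (0 < size Z)%N by case: (size Z) big; lia.
  have ZL : (0 < size Z * L ^ 2)%N by rewrite muln_gt0 Z0 expn_gt0 L0.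
  rewrite -(ltn_pmul2r ZL) -(ltn_pmul2r ZL); nia.
pose t (x : nat) : 'Z_q := (a * x%:R)^-1.
have tU : ~~ all (fun x => t x \in U) X.
  apply: contraL ltU => /allP allU; rewrite -leqNgt -(size_map t) -(card_uniqP _).
    by apply: subset_leq_card; apply/subsetP => _ /mapP[x xX ->]; exact: allU.
  rewrite map_inj_in_uniq // => x y xX yX /invr_inj /(mulrI ua) /(congr1 val).
  have [x1 _] := rX _ xX; have [y1 _] := rX _ yX.
  by rewrite /= !val_Zp_nat // !modn_small //; apply: leq_ltn_trans Nq.
have /allPn[x xX] := tU; rewrite inE => nall.
have [i nalli] := forallPn nall; have [j nallj] := forallPn nalli.
have [z zZ] := allPn nallj.
rewrite negbK => /eqP txE.
exists x, z, i, j; split=> //; rewrite -mulnA !natrM -txE mulrA divrr //.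
by rewrite unitrMl // unit_Zp_coprime //; case: (rX _ xX).
Qed.

(** The first bound is needed for [primes_between_doubles], the second to absorb the few primes
    discarded later, the third to limit the prime divisors of q above N to two. *)
Lemma cube_leq_bounds N k q : (2 ^ 18 <= q)%N -> (0 < k)%N ->
  (2 ^ 20 * k ^ 3 * q ^ 2 < N ^ 3)%N -> [/\ (2 ^ 18 <= N)%N, (16 * k < N)%N & (q < N ^ 3)%N].
Proof.
move=> q_ge k0 big; have le_exp m n : (m <= n)%N -> (2 ^ m <= 2 ^ n)%N by rewrite leq_exp2l.
have k3 : (0 < k ^ 3)%N by rewrite expn_gt0 k0.
have q1 : (0 < q)%N by apply: leq_trans q_ge; rewrite expn_gt0.
have q2 : (2 ^ 18 * q <= q ^ 2)%N by rewrite -mulnn leq_mul2r q_ge orbT.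
split.
- rewrite -(@leq_exp2r _ _ 3) // ltnW // (leq_ltn_trans _ big) //.
  rewrite (expnS (2 ^ 18)) -(mulnn (2 ^ 18)); apply: leq_mul.
    by apply: leq_trans (leq_pmulr _ k3); apply: le_exp.
  by apply: leq_trans q2; rewrite leq_mul2l q_ge orbT.
- rewrite -(@ltn_exp2r _ _ 3) // (leq_ltn_trans _ big) // expnMn.
  rewrite -mulnA; apply: leq_mul; last by rewrite leq_pmulr // expn_gt0 q1.
  by rewrite -[16%N]/(2 ^ 4)%N -expnM; apply: le_exp.
apply: leq_ltn_trans big; apply: (@leq_trans (q ^ 2)); first by rewrite -mulnn leq_pmulr.
by rewrite leq_pmull // muln_gt0 expn_gt0.
Qed.

(** The hypotheses give N^4 <= 80^2 k^2 M^2 L^2. If the conclusion failed, M^2 L^2 would be at most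
    102 N k q^2, because 16 N k + L <= 17 N k, contradicting the size of N^3. *)
Lemma size_bound_contra N k q M L : (0 < N)%N -> (N <= 16 * k * M)%N -> (N <= 5 * L)%N ->
  (4 * L <= N)%N -> (0 < k)%N ->
  (2 ^ 20 * k ^ 3 * q ^ 2 < N ^ 3)%N -> (6 * q ^ 2 * (16 * N * k + L) < M * M * L ^ 2)%N.
Proof.
move=> N0 M_ge L5 L4 k0 big; rewrite ltnNge; apply/negP => le_bad.
have : (N * N * (N * N) <= (16 * k * M) * (16 * k * M) * ((5 * L) * (5 * L)))%N.
  by rewrite !leq_mul.
apply/negP; rewrite -ltnNge.
have -> : ((16 * k * M) * (16 * k * M) * ((5 * L) * (5 * L)) =
  80 * 80 * k ^ 2 * (M * M * L ^ 2))%N by lia.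
apply: (@leq_ltn_trans (80 * 80 * k ^ 2 * (6 * q ^ 2 * (17 * N * k)))).
  rewrite leq_mul2l; apply/orP; right; apply: leq_trans le_bad _; rewrite leq_mul2l.
  by apply/orP; right; nia.
(* 6400 * 102 <= 2 ^ 20 *)
apply: (@leq_ltn_trans (N * (2 ^ 20 * k ^ 3 * q ^ 2))).
  have e c : (c * k ^ 2 * (6 * q ^ 2 * (17 * N * k)) = N * (c * 102 * k ^ 3 * q ^ 2))%N by ring.
  rewrite [leqLHS](e (80 * 80)%N).
  by rewrite !(leq_mul2l, leq_mul2r); apply/orP; right; apply/orP; right; lia.
by rewrite (_ : N * N * (N * N) = N * N ^ 3)%N ?ltn_pmul2l //; lia.
Qed.

Lemma three_coprime_congruence (R : realType) (q N k : nat) (a : 'Z_q) :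
  (2 ^ 18 <= q)%N -> (N.*2 < q <= 2 ^ k)%N -> (2 ^ 20 * k ^ 3 * q ^ 2 < N ^ 3)%N ->
  a \is a GRing.unit ->
  exists x y z : nat, [/\ (N < x <= N.*2)%N, (N < y <= N.*2)%N, (N < z <= N.*2)%N,
    [/\ coprime x y, coprime x z & coprime y z] & a * (x * y * z)%:R = 1].
Proof.
move=> q_ge Nqk big ua; have /andP[Nq qk] := Nqk.
have q1 : (1 < q)%N by lia.
have k0 : (0 < k)%N by case: k {Nqk big} qk => //; lia.
have [N18 kN qN] := cube_leq_bounds q_ge k0 big.
have qN1 : (q < N.+1 ^ 3)%N by apply: leq_trans qN _; rewrite leq_exp2r.
pose prs := [seq p <- index_iota N.+1 N.*2.+1 | prime p].
have N_le : (N <= k.*2 * size prs)%N by apply: primes_between_doubles => //; lia.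
have u_prs : uniq prs by rewrite filter_uniq ?iota_uniq.
have in_prs p : p \in prs -> prime p /\ (N < p <= N.*2)%N.
  by rewrite mem_filter mem_index_iota ltnS => /andP[].
have le2 : (count (dvdn^~ q) prs <= 2)%N.
  apply: (@count_prime_divisors _ N) => //.
  - by apply/allP => p /in_prs[].
  - by move=> p /in_prs[_ /andP[]].
  by rewrite (ltnW q1).
pose cop := [seq p <- prs | ~~ (p %| q)%N].
have size_cop : (size prs <= size cop + 2)%N.
  rewrite -(count_predC (dvdn^~ q)) addnC size_filter leq_add2l //.
have u_cop : uniq cop by rewrite filter_uniq.
have in_cop p : p \in cop -> [/\ prime p, (N < p <= N.*2)%N & coprime q p].
  rewrite mem_filter => /andP[nd /in_prs[pp rp]]; split=> //.
  by rewrite coprime_sym prime_coprime.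
(* With y and the primes in different halves of (N, 2N], y is not one of the primes,
   hence not a multiple of them since y <= 2N. *)
pose H := (N + N./2)%N; pose L := (N %/ 4)%N.
have L4 : (4 * L <= N)%N by rewrite mulnC leq_divM.
have L5 : (N <= 5 * L)%N by have := ltn_ceil N (isT : 0 < 4)%N; rewrite -/L; lia.
(* The half holding more of the primes is kept and [s] begins the other one, where s + i + j stays
   because i + j <= 2L - 2 < N/2. *)
have [P [s [sizeP rs]]] : exists (P : pred nat) s,
    (size cop <= (size (filter P cop)).*2)%N /\
    (forall i j p, (i < L -> j < L -> p \in filter P cop ->
      p != s + i + j /\ N < s + i + j <= N.*2)%N).
  have := count_predC (leq^~ H) cop.
  have [le1|lt1] := leqP (count (predC (leq^~ H)) cop) (count (leq^~ H) cop) => cE.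
    exists (leq^~ H), H.+1; split => //; first by rewrite size_filter; lia.
    by move=> i j p iL jL; rewrite mem_filter => /andP[/= pH _]; rewrite /H in pH *; lia.
  exists (predC (leq^~ H)), N.+1; split => //; first by rewrite size_filter; lia.
  by move=> i j p iL jL; rewrite mem_filter => /andP[/= pH _]; rewrite /H in pH *; lia.
set W := filter P cop in sizeP rs *.
have u_W : uniq W by rewrite filter_uniq.
have in_W p : p \in W -> p \in cop by rewrite mem_filter => /andP[].
pose M := (size W)./2.
have sX : size (take M W) = M by rewrite size_takel // /M; lia.
have sZ : (M <= size (drop M W))%N by rewrite size_drop /M; lia.
(* At most two primes divide q, and the list is then halved twice with rounding. *)
have M4 : (size prs <= 4 * M + 4)%N by rewrite /M; lia.
have M_ge : (N <= 16 * k * M)%N.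
  have : (N <= k.*2 * (4 * M + 4))%N by rewrite (leq_trans N_le) // leq_mul2l M4 orbT.
  have [M2|] := leqP 1 M; nia.
have [||||||||||||x [z [i [j [xX zZ iL jL e]]]]] :=
  @trilinear_congruence R q N k L s (take M W) (drop M W) a.
- by [].
- by [].
- exact: ltnW.
- by apply/andP; split; lia.
- exact: take_uniq.
- by move=> x /mem_take /in_W /in_cop[_ /andP[_ ?] ?].
- exact: drop_uniq.
- by apply/allP => x /mem_drop /in_W /in_cop[].
- by move=> x /mem_drop /in_W /in_cop[].
- by move=> x /mem_drop /in_W /in_cop[].
- by [].
- rewrite sX; apply: (@leq_trans (M * M * L ^ 2)); last by rewrite !leq_mul.
  by apply: size_bound_contra big => //; lia.
have xW := mem_take xX; have zW := mem_drop zZ.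
have [px rx cx] := in_cop _ (in_W _ xW); have [pz rz cz] := in_cop _ (in_W _ zW).
have [ney ry] := rs i j x iL jL xW; have [nez _] := rs i j z iL jL zW.
set y := (s + i + j)%N in e ney ry nez.
have not_dvd p : prime p -> (N < p)%N -> p != y -> coprime p y.
  move=> pp ltp ne; rewrite prime_coprime //; apply/negP => /dvdnP[m yE].
  case: m yE => [|[|m]] yE; [by rewrite yE in ry | by rewrite yE mul1n eqxx in ne |].
  have : (2 * p <= y)%N by rewrite yE leq_mul2r orbT.
  case/andP: ry => _ ry /leq_trans/(_ ry).
  by rewrite -mul2n leq_pmul2l // leqNgt ltp.
exists x, y, z; split=> //; last by rewrite mulnAC.
have /andP[x1 _] := rx; have /andP[z1 _] := rz.
split; [exact: not_dvd | | by rewrite coprime_sym not_dvd].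
rewrite prime_coprime // dvdn_prime2 //; apply/negP => /eqP exz.
move: u_W; rewrite -(cat_take_drop M W) cat_uniq => /and3P[_ /hasPn/(_ z zZ)].
by rewrite -exz xX.
Qed.

(** * Approximation by three fractions *)

(** The partial fraction decomposition of b / (x y z), from Bezout relations for x, y and for x y,
    z. *)
Lemma three_denominators_bezout (x y z : nat) (b : int) :
  coprime x y -> coprime x z -> coprime y z ->
  exists a1 a2 a3 : int, b = a1 * (y * z)%N%:Z + a2 * (x * z)%N%:Z + a3 * (x * y)%N%:Z.
Proof.
move=> cxy cxz cyz.
have /coprimezP[[u v] /= uv] : coprimez x y by rewrite coprimezE.
have /coprimezP[[s t] /= st] : coprimez (x * y)%N z by rewrite coprimezE !absz_nat coprimeMl cxz.
exists (b * t * v), (b * t * u), (b * s).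
rewrite -[LHS]mulr1 -st -[X in _ * (_ + X)]mulr1 -uv !PoszM; ring.
Qed.

(** With 2^eps = b^4 and b = 1 + d, Bernoulli's inequality gives (2^eps)^n >= (n d)^4, which beats
    2^23 (2n)^3 = 2^26 n^3 once n d^4 >= 2^26. *)
Lemma exp_beats_cube (R : realType) (eps : R) : 0 < eps ->
  exists K, forall n, (K <= n)%N -> 2 ^+ 23 * n.+1%:R ^+ 3 <= (2 `^ eps) ^+ n.
Proof.
move=> eps0; pose b : R := 2 `^ (eps / 4); pose d := b - 1.
have d0 : 0 < d.
  rewrite subr_gt0 -[1](powRr0 2); rewrite /b /powR pnatr_eq0 /= ltr_expR.
  rewrite ltr_pM2r ?ln_gt0 ?ltr1n //; lra.
have d4 : 0 < d ^+ 4 by rewrite exprn_gt0.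
exists (Num.bound (2 ^+ 26 / d ^+ 4)).+1 => n ltn.
have n_gt : 2 ^+ 26 <= n%:R * d ^+ 4.
  rewrite -ler_pdivrMr //; apply: (@le_trans _ _ (Num.bound (2 ^+ 26 / d ^+ 4))%:R).
    by apply: ltW; apply: archi_boundP; rewrite divr_ge0 ?exprn_ge0 // ltW.
  by rewrite ler_nat ltnW.
have bn : n%:R * d <= b ^+ n.
  have bE : b = 1 + d by rewrite /d addrC subrK.
  rewrite bE; elim: n {ltn n_gt} => [|n IHn]; first by rewrite mul0r expr0.
  have b1 : 1 <= (1 + d) ^+ n by rewrite exprn_ege1 // lerDl ltW.
  rewrite exprS mulrDl mul1r -natr1 mulrDl mul1r lerD // ler_peMr // ltW //.
have -> : (2 `^ eps) ^+ n = (b ^+ n) ^+ 4.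
  rewrite -exprM mulnC exprM; congr (_ ^+ n).
  by rewrite -powR_mulrn ?powR_ge0 // -powRrM divfK // pnatr_eq0.
have bn4 : (n%:R * d) ^+ 4 <= (b ^+ n) ^+ 4.
  by rewrite lerXn2r ?nnegrE ?mulr_ge0 ?exprn_ge0 ?powR_ge0 // ltW.
apply: le_trans bn4; have n1 : 1 <= n%:R :> R by rewrite (ler_nat _ 1); lia.
apply: (@le_trans _ _ (2 ^+ 23 * (2 * n%:R) ^+ 3)).
  rewrite ler_wpM2l ?exprn_ge0 // lerXn2r ?nnegrE ?mulr_ge0 //.
  by rewrite -natr1; lra.
rewrite (_ : 2 ^+ 23 * (2 * n%:R) ^+ 3 = n%:R ^+ 3 * 2 ^+ 26); last by ring.
rewrite (_ : (n%:R * d) ^+ 4 = n%:R ^+ 3 * (n%:R * d ^+ 4)); last by ring.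
by rewrite ler_wpM2l // exprn_ge0.
Qed.

(** For k the upper binary logarithm of q, q^eps >= (2^eps)^(k-1) >= 2^23 k^3. Hence 2^23 k^3 q^2 <=
    Q < (N + 1)^3 <= 2^3 N^3. *)
Lemma cube_root_large (R : realType) (eps : R) : 0 < eps ->
  exists K, forall q Q N : nat, (2 ^ K <= q)%N -> q%:R `^ (2 + eps) <= Q%:R :> R ->
    (Q < N.+1 ^ 3)%N -> exists2 k, (q <= 2 ^ k)%N & (2 ^ 20 * k ^ 3 * q ^ 2 < N ^ 3)%N.
Proof.
move=> eps0; have [K HK] := exp_beats_cube eps0.
(* The growth bound is applied at k - 1, hence the shift by one. *)
exists K.+1 => q Q N qK qQ QN.
have q1 : (1 < q)%N by apply: leq_trans qK; rewrite expnS; have := expn_gt0 2 K; lia.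
exists (up_log 2 q); first exact: up_logP.
have lt_q := up_log_gtn (isT : (1 < 2)%N) q1.
have leK : (K <= (up_log 2 q).-1)%N.
  have : (K.+1 <= up_log 2 q)%N by rewrite -(@leq_exp2l 2) // (leq_trans qK) // up_logP.
  lia.
have k0 : (0 < up_log 2 q)%N by rewrite up_log_gt0; lia.
have := HK _ leK; rewrite prednK //; set k := up_log 2 q in lt_q leK k0 * => Hk.
have q0 : 0 < q%:R :> R by rewrite ltr0n; lia.
have le_qeps : (2 `^ eps) ^+ k.-1 <= q%:R `^ eps.
  rewrite -powR_mulrn ?powR_ge0 // powRAC powR_mulrn // ge0_ler_powR ?nnegrE ?exprn_ge0 ?ler0n ?(ltW eps0) //.
  by rewrite -natrX ler_nat ltnW.
have le1 : (2 ^ 23 * k ^ 3 * q ^ 2)%N%:R <= Q%:R :> R.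
  apply: le_trans qQ; rewrite powRD; last by rewrite (gt_eqF q0) implybT.
  rewrite powR_mulrn ?ler0n // natrM natrX mulrC ler_wpM2l ?exprn_ge0 ?ler0n //.
  by apply: le_trans le_qeps; rewrite natrM !natrX.
rewrite ler_nat in le1.
have N1 : (0 < N)%N.
  rewrite lt0n; apply/eqP => N0; move: QN; rewrite N0 exp1n ltnS leqn0 => /eqP Q0.
  have : (0 < 2 ^ 23 * k ^ 3 * q ^ 2)%N by rewrite 2!muln_gt0 !expn_gt0 k0 (ltnW q1).
  by rewrite Q0 in le1; rewrite ltnNge le1.
have : (2 ^ 3 * (2 ^ 20 * k ^ 3 * q ^ 2) < 2 ^ 3 * N ^ 3)%N.
  rewrite (mulnA (2 ^ 3)%N) (mulnA (2 ^ 3)%N) -(expnD 2 3 20).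
  apply: leq_ltn_trans le1 _; apply: leq_trans QN _.
  by rewrite -expnMn leq_exp2r //; lia.
by rewrite ltn_pmul2l.
Qed.

Theorem theorem1 (R : realType) (eps : R) (heps : 0 < eps) :
  exists q0 : R, forall q : int, q0 <= q%:~R ->
  forall a : int, gcdz a q = 1 ->
  forall Q : int, (q%:~R : R) `^ (2 + eps) <= Q%:~R ->
  exists a1 a2 a3 q1 q2 q3 : int,
    [/\ 1 <= q1 /\ q1%:~R <= 2 * (Q%:~R : R) `^ (1 / 3),
        1 <= q2 /\ q2%:~R <= 2 * (Q%:~R : R) `^ (1 / 3),
        1 <= q3 /\ q3%:~R <= 2 * (Q%:~R : R) `^ (1 / 3) &
        `| (a%:~R / q%:~R - a1%:~R / q1%:~R - a2%:~R / q2%:~R - a3%:~R / q3%:~R : R) |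
          <= 1 / (q%:~R * Q%:~R) ].
Proof.
have [K HK] := cube_root_large heps.
(* [K] makes [cube_root_large] applicable, and 18 is the threshold of [three_coprime_congruence]. *)
exists ((2 ^ maxn K 18)%N%:R) => q; rewrite pmulrn ler_int.
case: q => [q|q]; last by rewrite NegzE => le; exfalso; move: le; have := expn_gt0 2 (maxn K 18); lia.
rewrite lez_nat => q_ge a aq Q.
have qK : (2 ^ K <= q)%N by apply: leq_trans q_ge; rewrite leq_exp2l // leq_maxl.
have q18 : (2 ^ 18 <= q)%N by apply: leq_trans q_ge; rewrite leq_exp2l // leq_maxr.
have q1 : (1 < q)%N by apply: leq_trans q18; rewrite (@leq_exp2l 2 1).
have q0 : 0 < q%:R :> R by rewrite ltr0n ltnW.
case: Q => [Q|Q] qQ; last first.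
  have := lt_le_trans (powR_gt0 (2 + eps) q0) qQ.
  by rewrite NegzE mulrNz oppr_gt0 ltrz0; lia.
rewrite -!pmulrn in qQ *.
have Q0 : (0 < Q)%N by rewrite -(ltr0n R) (lt_le_trans _ qQ) // powR_gt0.
have [N /andP[N_le N_gt]] : exists N, (N ^ 3 <= Q < N.+1 ^ 3)%N.
  have ex0 : exists i, (i ^ 3 <= Q)%N by exists 0%N.
  have bnd i : (i ^ 3 <= Q)%N -> (i <= Q)%N.
    by apply: leq_trans; case: i => // i; rewrite expnS leq_pmulr // expn_gt0.
  case: (ex_maxnP ex0 bnd) => N N1 N2; exists N; rewrite N1 ltnNge; apply/negP => /N2.
  by rewrite ltnn.
have N0 : (0 < N)%N by rewrite lt0n; apply: contraTneq N_gt => ->; rewrite exp1n -leqNgt.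
have N_root : N%:R <= (Q%:R : R) `^ (1 / 3).
  have -> : N%:R = ((N ^ 3)%N%:R : R) `^ (1 / 3).
    by rewrite natrX -powR_mulrn // -powRrM mulrC divfK ?pnatr_eq0 // powRr1.
  by rewrite ge0_ler_powR ?nnegrE ?ler0n ?ler_nat //; lra.
have small (m : nat) : (m <= N.*2)%N -> m%:R <= 2 * (Q%:R : R) `^ (1 / 3).
  move=> mN; apply: (@le_trans _ _ (2 * N%:R)); last by rewrite ler_wpM2l.
  by rewrite -natrM ler_nat mul2n.
have [q_le|q_gt] := leqP q N.*2.
  exists a, 0, 0, q%:Z, 1, 1; split.
  - by split; [lia | rewrite -pmulrn; exact: small].
  - by split => //; apply: (small 1%N); lia.
  - by split => //; apply: (small 1%N); lia.
  by rewrite -pmulrn subrr !mul0r !subr0 normr0 divr_ge0 // mulr_ge0 ?ler0n.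
have [k qk big] := HK _ _ _ qK qQ N_gt.
have ua : (a%:~R : 'Z_q) \is a GRing.unit.
  have /coprimezP[[u v] /= uv] : coprimez a q by rewrite /coprimez aq.
  apply/unitrP; exists u%:~R.
  have e : u%:~R * a%:~R = 1 :> 'Z_q.
    by rewrite -intrM -[RHS]/(1%:~R) -uv intrD !intrM -[q%:~R]pmulrn pchar_Zp // mulr0 addr0.
  by split=> //; rewrite mulrC.
have [||||x [y [z [rx ry rz [cxy cxz cyz] e]]]] := @three_coprime_congruence R q N k a%:~R.
- by [].
- by rewrite q_gt.
- by [].
- by [].
have /dvdzP[b bE] : (q %| a * (x * y * z)%N%:Z - 1)%Z.
  by rewrite -intr_Zp_eq0 // rmorphB rmorphM /= -pmulrn e subrr.
have [a1 [a2 [a3 bsum]]] := three_denominators_bezout b cxy cxz cyz.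
have /andP[x1 x2] := rx; have /andP[y1 y2] := ry; have /andP[z1 z2] := rz.
exists a1, a2, a3, x%:Z, y%:Z, z%:Z; rewrite -!pmulrn; split.
- by split; [lia | exact: small].
- by split; [lia | exact: small].
- by split; [lia | exact: small].
have x0 : 0 < x%:R :> R by rewrite ltr0n (leq_ltn_trans _ x1).
have y0 : 0 < y%:R :> R by rewrite ltr0n (leq_ltn_trans _ y1).
have z0 : 0 < z%:R :> R by rewrite ltr0n (leq_ltn_trans _ z1).
have bER : a%:~R * (x%:R * y%:R * z%:R) - 1 = b%:~R * q%:R :> R.
  have := congr1 (intr : int -> R) bE.
  by rewrite rmorphB !rmorphM /= -!pmulrn.
have bsumR : b%:~R = a1%:~R * (y%:R * z%:R) + a2%:~R * (x%:R * z%:R) + a3%:~R * (x%:R * y%:R) :> R.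
  by rewrite bsum !rmorphD !rmorphM /= -!pmulrn.
(* The three fractions sum to b / (x y z), and a x y z - b q = 1. *)
have -> : a%:~R / q%:R - a1%:~R / x%:R - a2%:~R / y%:R - a3%:~R / z%:R =
    1 / (q%:R * (x%:R * y%:R * z%:R)) :> R.
  transitivity ((a%:~R * (x%:R * y%:R * z%:R) - b%:~R * q%:R) /
      (q%:R * (x%:R * y%:R * z%:R)) : R); last by rewrite -bER opprB addrC subrK.
  by rewrite bsumR; field; rewrite !gt_eqF.
have Q0' : 0 < Q%:R :> R by rewrite ltr0n.
rewrite ger0_norm; last by rewrite divr_ge0 // !mulr_ge0 // ltW.
rewrite !div1r lef_pV2 ?posrE ?mulr_gt0 //.
(* Each denominator is at least N + 1, so that x y z >= (N + 1)^3 > Q. *)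
rewrite ler_wpM2l ?ler0n // -!natrM ler_nat; apply: leq_trans (ltnW N_gt) _.
by rewrite !expnS mulnA muln1 !leq_mul.
Qed.
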